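(* Let $G$ be a cubic graph with $n$ vertices and let $\mathcal{M}(G)$ be the magnification of $G$. Then $G$ admits an efficient edge dominating set if and only if $\mathcal{M}(G)$ has a perfect edge dominating set of size at most $\frac{57n}{10}$.
   Context: Graphs are finite, simple and undirected. An edge dominates itself and every edge sharing an endpoint with it. A set $P\subseteq E(G)$ is a perfect edge dominating set if every edge of $E(G)\setminus P$ is dominated by exactly one edge of $P$; it is an efficient edge dominating set if every edge of $E(G)$ is dominated by exactly one edge of $P$. The shield graph has vertices $v_1,\dots,v_{12}$ and edges $v_iv_{i+1}$ ($1\le i\le 11$), $v_{12}v_1$, $v_2v_4$, $v_6v_8$, $v_{10}v_{12}$; its contact vertices are $v_3,v_7,v_{11}$. For a cubic graph $G$, the magnification $\mathcal{M}(G)$ is obtained by replacing every vertex $v$ of $G$ by a copy $S_v$ of the shield graph, fixing for each $v$ a bijection between the three neighbours of $v$ in $G$ and the three contact vertices of $S_v$, and, for each edge $uv$ of $G$, adding an edge between the contact vertex of $S_u$ assigned to $v$ and the contact vertex of $S_v$ assigned to $u$. *)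

(* Defs.v *)
From mathcomp Require Import all_boot all_order all_algebra.

Set Implicit Arguments.
Unset Strict Implicit.
Unset Printing Implicit Defensive.

Record sgraph := SGraph {
  vertex :> finType;
  adj : rel vertex;
  adj_sym : symmetric adj;
  adj_irrefl : irreflexive adj }.

Definition neighbours (G : sgraph) (v : G) : {set G} := [set w | adj v w].

Definition cubic (G : sgraph) : Prop := forall v : G, #|neighbours v| = 3.

(* An edge is the two-element set of its endpoints. *)
Definition edges (G : sgraph) : {set {set G}} :=
  [set [set p.1; p.2] | p in [set p : G * G | adj p.1 p.2]].

(* Every edge meets itself, so this covers the domination of an edge by
   itself. *)
Definition dominates (G : sgraph) (f g : {set G}) : bool := f :&: g != set0.

Definition dominators (G : sgraph) (P : {set {set G}}) (g : {set G}) :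
    {set {set G}} :=
  [set f in P | dominates f g].

Definition perfect_edge_dominating (G : sgraph) (P : {set {set G}}) : Prop :=
  P \subset edges G /\
  forall g, g \in edges G :\: P -> #|dominators P g| = 1.

Definition efficient_edge_dominating (G : sgraph) (P : {set {set G}}) : Prop :=
  P \subset edges G /\
  forall g, g \in edges G -> #|dominators P g| = 1.

(* The vertex v_k of the shield graph is the ordinal of value k - 1, so the
   contact vertices v_3, v_7, v_11 have values 2, 6, 10. *)
Definition shield_edge_list : seq (nat * nat) :=
  [:: (0, 1); (1, 2); (2, 3); (3, 4); (4, 5); (5, 6); (6, 7); (7, 8); (8, 9);
      (9, 10); (10, 11); (11, 0); (1, 3); (5, 7); (9, 11)].

Definition shield_adj : rel 'I_12 := fun i j =>
  ((i : nat, j : nat) \in shield_edge_list)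
  || ((j : nat, i : nat) \in shield_edge_list).

Lemma shield_adj_sym : symmetric shield_adj.
Proof. by move=> i j; rewrite /shield_adj orbC. Qed.

Lemma shield_adj_irrefl : irreflexive shield_adj.
Proof. by case; do 12?[case=> //]. Qed.

Definition shield : sgraph := SGraph shield_adj_sym shield_adj_irrefl.

Definition contacts : {set shield} :=
  [set i : shield | val i \in [:: 2; 6; 10]].

(* c v w is the contact vertex of S_v assigned to the neighbour w of v; the
   values c v w at non-neighbours w are irrelevant. *)
Definition contact_assignment (G : sgraph) (c : G -> G -> shield) : Prop :=
  forall v : G,
    {in neighbours v &, injective (c v)} /\ c v @: neighbours v = contacts.

(* (v, i) is the vertex i of the copy S_v of the shield graph. *)
Definition magnification_adj (G : sgraph) (c : G -> G -> shield) :
    rel (G * shield)%type := fun x y =>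
  (x.1 == y.1) && adj x.2 y.2
  || [&& adj x.1 y.1, x.2 == c x.1 y.1 & y.2 == c y.1 x.1].

Lemma magnification_adj_sym (G : sgraph) (c : G -> G -> shield) :
  symmetric (magnification_adj c).
Proof.
move=> x y; rewrite /magnification_adj eq_sym [adj x.2 _]adj_sym.
by rewrite [adj x.1 _]adj_sym [(x.2 == _) && _]andbC.
Qed.

Lemma magnification_adj_irrefl (G : sgraph) (c : G -> G -> shield) :
  irreflexive (magnification_adj c).
Proof. by move=> x; rewrite /magnification_adj !adj_irrefl andbF. Qed.

Definition magnification (G : sgraph) (c : G -> G -> shield) : sgraph :=
  SGraph (magnification_adj_sym c) (magnification_adj_irrefl c).

(* Main.v *)
Require Import Defs.
From mathcomp Require Import all_boot all_order all_algebra.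
From mathcomp Require Import zify.

(* A perfect edge dominating set P is the set of edges induced by the set S of
   vertices it covers, and S is characterised by a local condition: all
   neighbours of x lie in S, unless x lies in S and has exactly one neighbour in
   S.  The efficient sets are those where the latter holds at every x in S.

   In a magnification, checking the 2^15 states of a shield and of the three
   vertices attached to its contacts leaves three types, by the covered
   contacts, the number k of attached vertices that are covered and the sum w of
   the P-degrees: contacts uncovered, k = 3, w = 6; contacts covered, k = 1,
   w = 15; contacts covered, k = 3, w = 33.  Let S be the set of vertices of G
   whose shield has covered contacts.  Then k is the number of neighbours in S,
   and double counting the edges leaving S gives 10 |P| = 57 n + 108 f, where f
   counts the shields of the third type.  So the bound means f = 0, i.e. that S
   is the cover of an efficient edge dominating set. *)

Set Implicit Arguments.
Unset Strict Implicit.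
Unset Printing Implicit Defensive.

(** * Edge sets and the vertex sets they cover *)

Definition incident (H : sgraph) (P : {set {set H}}) (x : H) : {set {set H}} :=
  [set f in P | x \in f].

Definition covered (H : sgraph) (P : {set {set H}}) : {set H} :=
  [set x | incident P x != set0].

Definition induced_edges (H : sgraph) (S : {set H}) : {set {set H}} :=
  [set f in edges H | f \subset S].

Definition degree_in (H : sgraph) (S : {set H}) (x : H) : nat :=
  #|neighbours x :&: S|.

Definition perfect_at (H : sgraph) (S : {set H}) (x : H) : bool :=
  (degree_in S x == #|neighbours x|) || (x \in S) && (degree_in S x == 1).

Lemma adj_neq (H : sgraph) (x y : H) : adj x y -> x != y.
Proof. by case: eqP => // <-; rewrite adj_irrefl. Qed.

Lemma set2_inj (T : finType) (x y z : T) :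
  x != y -> [set x; y] = [set x; z] -> y = z.
Proof.
move=> xy /setP/(_ y); rewrite !inE eqxx orbT eq_sym (negPf xy) /=.
by move/esym/eqP.
Qed.

Lemma edgesP (H : sgraph) (f : {set H}) :
  reflect (exists x y, adj x y /\ f = [set x; y]) (f \in edges H).
Proof.
apply: (iffP imsetP) => [[[x y]]|[x [y [xy ->]]]].
  by rewrite inE /= => xy ->; exists x, y.
by exists (x, y); rewrite ?inE.
Qed.

Lemma edge_eq (H : sgraph) (f : {set H}) (x y : H) :
  f \in edges H -> x \in f -> y \in f -> x != y -> f = [set x; y].
Proof.
case/edgesP => a [b [_ ->]]; rewrite !inE.
case/orP=> /eqP->; case/orP=> /eqP->; rewrite ?eqxx // => _.
exact: setUC.
Qed.

Lemma set2_in_edges (H : sgraph) (x y : H) : ([set x; y] \in edges H) = adj x y.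
Proof.
apply/edgesP/idP => [[a [b [ab e]]]|xy]; last by exists x, y.
have: x \in [set a; b] by rewrite -e set21.
rewrite !inE => /orP[]/eqP xe; subst x.
  by rewrite -(set2_inj (adj_neq ab) (esym e)).
rewrite adj_sym in ab; rewrite (setUC [set a]) in e.
by rewrite -(set2_inj (adj_neq ab) (esym e)).
Qed.

(** Inclusion-exclusion over the two ends: the only edge that can contain both [x] and [y] is
    [[set x; y]] itself. *)
Lemma card_dominators (H : sgraph) (P : {set {set H}}) (x y : H) :
  P \subset edges H -> adj x y ->
  #|dominators P [set x; y]| + ([set x; y] \in P)
    = #|incident P x| + #|incident P y|.
Proof.
move=> /subsetP PE xy; rewrite -cardsUI; congr (_ + _).
  apply: eq_card => f; rewrite !inE -andb_orr; congr (_ && _).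
  apply/set0Pn/orP => [[z]|[xf|yf]]; rewrite ?inE.
  - by case/andP => zf /orP[]/eqP<-; [left|right].
  - by exists x; rewrite !inE xf eqxx.
  - by exists y; rewrite !inE yf eqxx orbT.
have -> : incident P x :&: incident P y = [set f in P | f == [set x; y]].
  apply/setP => f; rewrite !inE; case fP: (f \in P) => //=.
  apply/andP/eqP => [[xf yf]|->]; last by rewrite !inE !eqxx orbT.
  exact: edge_eq (PE _ fP) xf yf (adj_neq xy).
case: (boolP (_ \in P)) => xyP.
  rewrite /= -(cards1 [set x; y]); apply: eq_card => f; rewrite !inE.
  by case: eqP => [->|]; rewrite ?xyP ?andbF.
apply/esym/eqP; rewrite cards_eq0; apply/eqP/setP => f; rewrite !inE.
by case: eqP => [->|]; rewrite ?(negPf xyP) ?andbF.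
Qed.

Lemma sum_card_incident (H : sgraph) (P : {set {set H}}) :
  P \subset edges H -> \sum_x #|incident P x| = 2 * #|P|.
Proof.
move=> /subsetP PE.
transitivity (\sum_x \sum_(f in P) (x \in f : nat)).
  apply: eq_bigr => x _; rewrite -sum1_card big_mkcond [RHS]big_mkcond.
  by apply: eq_bigr => f _; rewrite inE; case: (f \in P); case: (x \in f).
rewrite exchange_big /= mulnC -sum_nat_const; apply: eq_bigr => f fP.
have [x [y [xy ->]]] := edgesP _ (PE _ fP).
have := cards2 x y; rewrite (adj_neq xy) -sum1_card big_mkcond /= => <-.
by apply: eq_bigr => z _; case: (z \in _).
Qed.

Lemma card_incident_induced (H : sgraph) (S : {set H}) (x : H) :
  #|incident (induced_edges S) x| = if x \in S then degree_in S x else 0.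
Proof.
case: ifPn => xS; last first.
  apply/eqP; rewrite cards_eq0; apply/eqP/setP => f; rewrite !inE.
  apply/negP => /andP[/andP[_ /subsetP fS] xf].
  by rewrite (fS _ xf) in xS.
have -> : incident (induced_edges S) x
    = [set [set x; y] | y in neighbours x :&: S].
  apply/setP => f; apply/idP/imsetP => [|[y]]; rewrite !inE.
    case/andP=> /andP[/edgesP[a [b [ab ->]]]]; rewrite subUset !sub1set.
    case/andP=> aS bS; rewrite !inE => /orP[]/eqP->.
      by exists b; rewrite // !inE ab.
    by exists a; rewrite 1?setUC // !inE adj_sym ab.
  case/andP=> xy yS ->; rewrite set2_in_edges xy subUset !sub1set xS yS.
  by rewrite !inE eqxx.
apply: card_in_imset => y z; rewrite !inE => /andP[xy _] _.
exact: set2_inj (adj_neq xy).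
Qed.

(** An edge outside [P] with both ends covered would have at least two dominators, one at each
    end. *)
Lemma perfect_edges_induced (H : sgraph) (P : {set {set H}}) :
  perfect_edge_dominating P -> P = induced_edges (covered P).
Proof.
case=> PE domP; apply/setP => f; apply/idP/idP => [fP|].
  rewrite inE (subsetP PE) //=; apply/subsetP => x xf.
  by rewrite inE; apply/set0Pn; exists f; rewrite inE fP.
rewrite inE => /andP[fE]; have [x [y [xy ef]]] := edgesP _ fE; rewrite ef.
rewrite subUset !sub1set !inE -!card_gt0 => /andP[x0 y0].
apply: contraTT (x0) => xyP.
have := card_dominators PE xy; rewrite domP ?inE ?(negPf xyP) -?ef ?fE //.
lia.
Qed.

(** The [P]-degrees at the ends of an edge outside [P] sum to 1, so a vertex with an uncovered
    neighbour has [P]-degree 1. *)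
Lemma perfect_perfect_at (H : sgraph) (P : {set {set H}}) :
  perfect_edge_dominating P -> forall x, perfect_at (covered P) x.
Proof.
move=> perfP x; have [PE domP] := perfP.
have two y : adj x y -> [set x; y] \notin P ->
    #|incident P x| + #|incident P y| = 1.
  move=> xy xyP; rewrite -card_dominators // (negPf xyP) addn0 domP //.
  by rewrite inE xyP set2_in_edges.
have notP y z f : y \notin covered P -> f = [set y; z] -> f \notin P.
  rewrite inE negbK => /eqP/setP y0 ef; apply/negP => fP.
  by have := y0 f; rewrite !inE fP ef !inE eqxx.
rewrite /perfect_at; case: (boolP (neighbours x \subset covered P)).
  by move=> /setIidPl e; rewrite /degree_in e eqxx.
case/subsetPn => y; rewrite inE => xy yS; apply/orP; right.
have := two y xy (notP y x _ yS (setUC _ _)).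
have -> : #|incident P y| = 0.
  by move: yS; rewrite inE negbK => /eqP->; rewrite cards0.
rewrite {1}(perfect_edges_induced perfP) card_incident_induced.
by case: ifP => // _; rewrite addn0 => ->.
Qed.

Lemma efficient_perfect (H : sgraph) (P : {set {set H}}) :
  efficient_edge_dominating P -> perfect_edge_dominating P.
Proof. by case=> PE domP; split=> // g; rewrite inE => /andP[_ /domP]. Qed.

(** An edge of [P] is its own sole dominator, so by [card_dominators] its ends have positive
    [P]-degrees with sum 2. *)
Lemma efficient_degree_in (H : sgraph) (P : {set {set H}}) :
  efficient_edge_dominating P ->
  {in covered P, forall x, degree_in (covered P) x = 1}.
Proof.
move=> effP x xS; have [PE domP] := effP.
have <- : #|incident P x| = degree_in (covered P) x.
  rewrite {1}(perfect_edges_induced (efficient_perfect effP)).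
  by rewrite card_incident_induced xS.
move: xS; rewrite inE => /set0Pn[f]; rewrite inE => /andP[fP xf].
have [y [xy ef]] : exists y, adj x y /\ f = [set x; y].
  have [a [b [ab ef]]] := edgesP _ (subsetP PE _ fP).
  move: xf; rewrite ef !inE => /orP[]/eqP->; first by exists b.
  by exists a; rewrite adj_sym setUC.
have := card_dominators PE xy; rewrite -ef fP domP ?(subsetP PE) //.
have : 0 < #|incident P x|.
  by rewrite card_gt0; apply/set0Pn; exists f; rewrite inE fP.
have : 0 < #|incident P y|.
  by rewrite card_gt0; apply/set0Pn; exists f; rewrite !inE fP ef set22.
lia.
Qed.

Lemma induced_edges_sub (H : sgraph) (S : {set H}) :
  induced_edges S \subset edges H.
Proof. by apply/subsetP => f; rewrite inE => /andP[]. Qed.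

Lemma perfect_at_adj (H : sgraph) (S : {set H}) (x y : H) :
  perfect_at S x -> adj x y -> y \notin S -> (x \in S) && (degree_in S x == 1).
Proof.
case/orP => // /eqP e xy yS.
have: neighbours x :&: S = neighbours x.
  by apply/eqP; rewrite eqEcard subsetIl -/(degree_in S x) e leqnn.
by move/setIidPl/subsetP/(_ y); rewrite inE (negPf yS) => /(_ xy).
Qed.

Lemma induced_edges_perfect (H : sgraph) (S : {set H}) :
  (forall x, perfect_at S x) -> perfect_edge_dominating (induced_edges S).
Proof.
move=> perf; split=> [|g]; first exact: induced_edges_sub.
rewrite inE => /andP[gP gE]; have [x [y [xy eg]]] := edgesP _ gE.
have := card_dominators (induced_edges_sub S) xy.
rewrite -eg (negPf gP) addn0 !card_incident_induced => ->.
(* An edge that is not induced has an end outside [S]. That end contributes 0 and, by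
   [perfect_at_adj], the other contributes 1. *)
move: gP; rewrite inE gE /= eg subUset !sub1set negb_and => /orP[] zS.
  rewrite adj_sym in xy.
  by have /andP[-> /eqP->] := perfect_at_adj (perf y) xy zS; rewrite (negPf zS).
by have /andP[-> /eqP->] := perfect_at_adj (perf x) xy zS; rewrite (negPf zS).
Qed.

Lemma induced_edges_efficient (H : sgraph) (S : {set H}) :
  (forall x, perfect_at S x) -> {in S, forall x, degree_in S x = 1} ->
  efficient_edge_dominating (induced_edges S).
Proof.
move=> perf one; split=> [|g gE]; first exact: induced_edges_sub.
case: (boolP (g \in induced_edges S)) => gP; last first.
  by apply: (induced_edges_perfect perf).2; rewrite inE gP.
have [x [y [xy eg]]] := edgesP _ gE; have := gP.
rewrite inE gE /= eg subUset !sub1set => /andP[xS yS].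
have := card_dominators (induced_edges_sub S) xy.
by rewrite -eg gP !card_incident_induced xS yS !one // => /addIn.
Qed.

Lemma double_card_induced (H : sgraph) (S : {set H}) :
  2 * #|induced_edges S| = \sum_x (x \in S) * degree_in S x.
Proof.
rewrite -sum_card_incident ?induced_edges_sub //; apply: eq_bigr => x _.
by rewrite card_incident_induced; case: ifP; rewrite ?mul1n.
Qed.

(** * Exhaustive analysis of a single shield *)

(** Explicit adjacency lists let the case check run by plain evaluation. *)
Definition shield_table : seq (seq nat) :=
  [:: [:: 1; 11]; [:: 0; 2; 3]; [:: 1; 3]; [:: 1; 2; 4]; [:: 3; 5];
      [:: 4; 6; 7]; [:: 5; 7]; [:: 5; 6; 8]; [:: 7; 9]; [:: 8; 10; 11];
      [:: 9; 11]; [:: 0; 9; 10]].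

Definition shield_nbrs (i : nat) : seq nat := nth [::] shield_table i.

(* A shield inside a magnification: b i says that its vertex i is covered, e i
   that i is a contact whose neighbour outside the shield is covered. *)
Definition local_degree (b e : pred nat) (i : nat) : nat :=
  count b (shield_nbrs i) + e i.

(** The first test compares with the degree in the magnification, which at a contact exceeds the
    shield degree by one. *)
Definition local_perfect_at (b e : pred nat) (i : nat) : bool :=
  (local_degree b e i == size (shield_nbrs i) + (i \in [:: 2; 6; 10]))
  || b i && (local_degree b e i == 1).

Definition local_perfect (b e : pred nat) : bool :=
  all (local_perfect_at b e) (iota 0 12).

Definition local_weight (b e : pred nat) : nat :=
  sumn [seq b i * local_degree b e i | i <- iota 0 12].

Definition local_type (b e : pred nat) : bool :=
  [&& b 6 == b 2, b 10 == b 2 &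
      (e 2 + e 6 + e 10, local_weight b e)
        \in if b 2 then [:: (1, 15); (3, 33)] else [:: (3, 6)]].

Fixpoint all_bits (n : nat) (f : pred bitseq) : bool :=
  if n is m.+1 then
    all_bits m (fun s => f (true :: s)) && all_bits m (fun s => f (false :: s))
  else f [::].

Lemma all_bitsP (n : nat) (f : pred bitseq) (s : bitseq) :
  all_bits n f -> size s = n -> f s.
Proof.
elim: n f s => [|n IHn] f [|[] s] //= /andP[ft ff] [ss].
  exact: (IHn (fun s => f (true :: s))).
exact: (IHn (fun s => f (false :: s))).
Qed.

(* The last three of the 15 bits belong to the contacts 2, 6, 10, whose
   quotients by 4 are 0, 1, 2. *)
Lemma local_types_bits :
  all_bits 15 (fun s =>
    let b i := nth false s i in
    let e i := (i \in [:: 2; 6; 10]) && nth false s (12 + i %/ 4) in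
    local_perfect b e ==> local_type b e).
Proof. by []. Qed.

Lemma shield_nbrs_lt (i j : nat) : i < 12 -> j \in shield_nbrs i -> j < 12.
Proof.
move=> i12; have /allP : all (all (gtn 12)) shield_table by [].
by move/(_ _ (mem_nth [::] (i12 : i < size shield_table)))/allP/(_ j).
Qed.

(** Only indices below 12 are ever read, so bit functions can be exchanged for finite tables or
    closed formulas. *)
Lemma eq_local_degree (b b' e e' : pred nat) (i : nat) :
  {in gtn 12, b =1 b'} -> {in gtn 12, e =1 e'} -> i < 12 ->
  local_degree b e i = local_degree b' e' i.
Proof.
move=> eb ee i12; rewrite /local_degree ee //; congr (_ + _).
by apply: eq_in_count => j /(shield_nbrs_lt i12); apply: eb.
Qed.

Lemma eq_local_perfect (b b' e e' : pred nat) :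
  {in gtn 12, b =1 b'} -> {in gtn 12, e =1 e'} ->
  local_perfect b e = local_perfect b' e'.
Proof.
move=> eb ee; apply: eq_in_all => i; rewrite mem_iota add0n => i12.
by rewrite /local_perfect_at (eq_local_degree eb ee) // eb.
Qed.

Lemma eq_local_weight (b b' e e' : pred nat) :
  {in gtn 12, b =1 b'} -> {in gtn 12, e =1 e'} ->
  local_weight b e = local_weight b' e'.
Proof.
move=> eb ee; congr sumn; apply/eq_in_map => i; rewrite mem_iota add0n => i12.
by rewrite (eq_local_degree eb ee) // eb.
Qed.

Lemma local_perfect_type (b e : pred nat) :
  (forall i, e i -> i \in [:: 2; 6; 10]) -> local_perfect b e -> local_type b e.
Proof.
move=> e_contact.
(* The 15 relevant values are tabulated in the layout expected by [local_types_bits]. *)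
pose s := [seq b i | i <- iota 0 12] ++ [:: e 2; e 6; e 10].
pose b' i := nth false s i.
pose e' i := (i \in [:: 2; 6; 10]) && nth false s (12 + i %/ 4).
have eb : {in gtn 12, b =1 b'} by do 12![case=> //].
have ee : {in gtn 12, e =1 e'}.
  move=> i _; rewrite /e'; case: (boolP (i \in _)) => [|ni].
    by rewrite !inE => /or3P[]/eqP->.
  by apply/negbTE; apply: contra ni; apply: e_contact.
have /implyP := all_bitsP (s := s) local_types_bits erefl.
rewrite -/b' -/e' (eq_local_perfect eb ee) => H /H.
by rewrite /local_type (eq_local_weight eb ee) !eb // !ee.
Qed.

Lemma shield_nbrsE (i : nat) :
  i < 12 ->
  shield_nbrs i = [seq j <- iota 0 12 | ((i, j) \in shield_edge_list)
                                        || ((j, i) \in shield_edge_list)].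
Proof. by do 12![case: i => [//|i]]. Qed.

Lemma sum_shield_nbrs (b : pred nat) (i : 'I_12) :
  \sum_(j : 'I_12 | shield_adj i j) (b j : nat) = count b (shield_nbrs i).
Proof.
rewrite shield_nbrsE // -sum1_count big_filter_cond.
rewrite -[iota 0 12]/(index_iota 0 12) big_mkord [RHS]big_mkcondr /=.
by apply: eq_bigr => j _; case: (b j).
Qed.

(** * Reading a magnification shield by shield *)

(** [inord] sends an index above 11 to a default vertex; this is harmless, as such bits are never
    read. *)
Definition copy_bits (G : sgraph) (c : G -> G -> shield)
    (T : {set magnification c}) (v : G) : pred nat :=
  fun i => ((v, inord i) : magnification c) \in T.

Definition contact_bits (G : sgraph) (c : G -> G -> shield)
    (T : {set magnification c}) (v : G) : pred nat :=
  fun i => [exists w, [&& adj v w, val (c v w) == i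
                        & ((w, c w v) : magnification c) \in T]].

Lemma copy_bitsE (G : sgraph) (c : G -> G -> shield)
    (T : {set magnification c}) (v : G) (i : shield) :
  copy_bits T v (val i) = (((v, i) : magnification c) \in T).
Proof. by rewrite /copy_bits inord_val. Qed.

Lemma contact_vals (G : sgraph) (c : G -> G -> shield) (v w : G) :
  contact_assignment c -> adj v w -> val (c v w) \in [:: 2; 6; 10].
Proof.
move=> hc vw; have [_ im] := hc v.
have : c v w \in contacts by rewrite -im; apply: imset_f; rewrite inE.
by rewrite inE.
Qed.

(** Since [c v] is injective on neighbours, at most one [w] is assigned to the contact [i]. *)
Lemma sum_contact_bits (G : sgraph) (c : G -> G -> shield)
    (T : {set magnification c}) (v : G) (i : nat) :
  contact_assignment c ->
  \sum_(w | adj v w && (val (c v w) == i))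
     (((w, c w v) : magnification c) \in T : nat) = contact_bits T v i.
Proof.
move=> hc; case: (boolP (contact_bits T v i)) => [/existsP[w]|].
  case/and3P=> vw cw wT; rewrite (bigD1 w) /= ?vw // wT big1 // => u.
  case/andP=> /andP[vu cu] uw; have [inj _] := hc v.
  case/eqP: uw; apply: inj; rewrite ?inE //.
  by apply: ord_inj; exact: etrans (eqP cu) (esym (eqP cw)).
move/existsPn => H; apply: big1 => w /andP[vw cw].
by have := H w; rewrite vw cw /= => /negPf->.
Qed.

Lemma degree_in_copy (G : sgraph) (c : G -> G -> shield)
    (T : {set magnification c}) (v : G) (i : shield) :
  contact_assignment c ->
  degree_in T ((v, i) : magnification c)
    = local_degree (copy_bits T v) (contact_bits T v) (val i).
Proof.
move=> hc; rewrite /local_degree -sum_shield_nbrs -sum_contact_bits //.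
rewrite /degree_in -sum1_card big_mkcond /=.
(* A neighbour lies in the same copy or across a contact edge; irreflexivity in [G] makes the two
   cases exclusive. *)
transitivity (\sum_(w : G) \sum_(j : shield)
   ((v == w) * (shield_adj i j && (((v, j) : magnification c) \in T))
    + [&& adj v w, c v w == i, j == c w v
        & ((w, c w v) : magnification c) \in T])).
  rewrite pair_bigA; apply: eq_bigr => -[w j] _ /=.
  rewrite !inE /magnification_adj /=.
  case: (v =P w) => [<-|/eqP/negPf vw].
    rewrite /magnification_adj /= eqxx adj_irrefl orbF addn0 mul1n.
    by case: (_ && _).
  rewrite /magnification_adj /= vw mul0n add0n [i == _]eq_sym.
  case: (adj v w) => //=; case: (c v w == i) => //=.
  by case: eqP => [->|]; case: (_ \in T).
have -> : \sum_(j : 'I_12 | shield_adj i j) (copy_bits T v j : nat)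
    = \sum_(j : shield) (shield_adj i j && (((v, j) : magnification c) \in T)).
  rewrite big_mkcond; apply: eq_bigr => j _.
  by rewrite (copy_bitsE _ _ j); case: shield_adj.
rewrite [X in _ = _ + X]big_mkcond /=.
under eq_bigr do rewrite big_split /=.
rewrite big_split /=; congr (_ + _).
  rewrite (bigD1 v) //= [X in _ + X]big1 ?addn0 => [|w wv].
    by apply: eq_bigr => j _; rewrite eqxx mul1n.
  by rewrite eq_sym (negPf wv); apply: big1.
apply: eq_bigr => w _; rewrite (bigD1 (c w v)) //= big1 ?addn0 => [|j jw].
  by rewrite eqxx -val_eqE /=; case: (adj v w); case: (_ == _).
by rewrite (negPf jw) !andbF.
Qed.

Lemma degree_in_setT (H : sgraph) (x : H) : degree_in setT x = #|neighbours x|.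
Proof. by rewrite /degree_in setIT. Qed.

Lemma contact_bits_setT (G : sgraph) (c : G -> G -> shield) (v : G) (i : nat) :
  contact_assignment c ->
  contact_bits (setT : {set magnification c}) v i = (i \in [:: 2; 6; 10]).
Proof.
move=> hc; apply/existsP/idP => [[w /and3P[vw /eqP<- _]]|ic].
  exact: contact_vals.
have i12 : i < 12 by move: ic; rewrite !inE => /or3P[]/eqP->.
have [_ im] := hc v.
have : (Ordinal i12 : shield) \in contacts by rewrite inE.
rewrite -im => /imsetP[w]; rewrite inE => vw e.
by exists w; rewrite vw -e eqxx inE.
Qed.

Lemma perfect_at_copy (G : sgraph) (c : G -> G -> shield)
    (T : {set magnification c}) (v : G) (i : shield) :
  contact_assignment c ->
  perfect_at T ((v, i) : magnification c)
    = local_perfect_at (copy_bits T v) (contact_bits T v) (val i).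
Proof.
move=> hc; rewrite /perfect_at /local_perfect_at degree_in_copy //.
(* The full degree is the degree in [setT], so [degree_in_copy] evaluates both sides of the test. *)
rewrite -degree_in_setT degree_in_copy // {2}/local_degree contact_bits_setT //.
rewrite copy_bitsE; congr ((_ == _) || _); congr (_ + _).
by rewrite -count_predT; apply: eq_count => j; rewrite /copy_bits inE.
Qed.

Lemma perfect_magnification (G : sgraph) (c : G -> G -> shield)
    (T : {set magnification c}) :
  contact_assignment c ->
  (forall x, perfect_at T x) <->
  (forall v, local_perfect (copy_bits T v) (contact_bits T v)).
Proof.
move=> hc; split=> perf => [v|[v i]].
  apply/allP => i; rewrite mem_iota add0n => i12.
  by have := perf (v, Ordinal i12 : shield); rewrite perfect_at_copy.
rewrite perfect_at_copy //; apply: (allP (perf v)).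
by rewrite mem_iota add0n /=.
Qed.

Lemma double_card_induced_magnification (G : sgraph) (c : G -> G -> shield)
    (T : {set magnification c}) :
  contact_assignment c ->
  2 * #|induced_edges T|
    = \sum_v local_weight (copy_bits T v) (contact_bits T v).
Proof.
move=> hc; rewrite double_card_induced.
transitivity (\sum_v \sum_(i : shield) (((v, i) : magnification c) \in T)
                                     * degree_in T ((v, i) : magnification c)).
  by rewrite pair_bigA; apply: eq_bigr => -[].
apply: eq_bigr => v _; rewrite /local_weight sumnE big_map.
rewrite -[iota 0 12]/(index_iota 0 12) big_mkord; apply: eq_bigr => i _.
by rewrite degree_in_copy // -copy_bitsE.
Qed.

(** Every neighbour of [v] is assigned to exactly one of the three contacts, so the three bits
    together count each covered neighbour once. *)
Lemma degree_in_contact_bits (G : sgraph) (c : G -> G -> shield)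
    (T : {set magnification c}) (S : {set G}) (v : G) :
  contact_assignment c ->
  (forall w, adj v w -> (((w, c w v) : magnification c) \in T) = (w \in S)) ->
  degree_in S v
    = contact_bits T v 2 + contact_bits T v 6 + contact_bits T v 10.
Proof.
move=> hc TS; rewrite -!sum_contact_bits // !(big_mkcond (fun w => _ && _)) /=.
rewrite -!big_split /= /degree_in -sum1_card big_mkcond /=.
apply: eq_bigr => w _; rewrite !inE; case vw: (adj v w) => //=.
have := contact_vals hc vw; rewrite !inE TS //.
by case/or3P=> /eqP-> /=; case: (w \in S).
Qed.

(** * Double counting of the edges leaving a vertex set *)

Lemma sum_degree_in_sym (H : sgraph) (A B : {set H}) :
  \sum_(x in A) degree_in B x = \sum_(x in B) degree_in A x.
Proof.
have E (C D : {set H}) : \sum_(x in C) degree_in D x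
    = \sum_(x in C) \sum_(y in D) (adj x y : nat).
  apply: eq_bigr => x _; rewrite /degree_in -sum1_card !big_mkcond /=.
  rewrite [RHS]big_mkcond /=; apply: eq_bigr => y _; rewrite !inE.
  by case: (adj x y); case: (y \in D).
rewrite !E exchange_big /=; apply: eq_bigr => x _.
by apply: eq_bigr => y _; rewrite adj_sym.
Qed.

(* Discharging: a vertex outside S receives 9/5 from each of its three
   neighbours, all of which lie in S. *)
Lemma sum_weights (G : sgraph) (S : {set G}) (W : G -> nat) :
  cubic G ->
  (forall v, (degree_in S v, W v)
     \in if v \in S then [:: (1, 15); (3, 33)] else [:: (3, 6)]) ->
  5 * \sum_v W v = 57 * #|G| + 108 * #|[set v in S | degree_in S v != 1]|.
Proof.
move=> hcubic hW; have := sum_degree_in_sym (~: S) S.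
set L := \sum_(x in ~: S) _; set R := \sum_(x in S) _ => LR.
set F := [set v in S | _].
(* Scaled by 5, the identity holds vertex by vertex: 30 + 27 = 57 outside [S], and 75 = 57 + 18 or
   165 = 57 + 108 inside. *)
suff : 5 * (\sum_v W v) + 9 * L = 57 * #|G| + 108 * #|F| + 9 * R.
  by rewrite LR => /addIn.
rewrite /L /R (big_mkcond (fun v => v \in ~: S)).
rewrite (big_mkcond (fun v => v \in S)).
rewrite -[#|F|]sum1_card -[#|G|]sum1_card (big_mkcond (fun v => v \in F)) /=.
rewrite !big_distrr -!big_split /=; apply: eq_bigr => v _.
have : degree_in (~: S) v + degree_in S v = 3.
  by rewrite -(hcubic v) addnC -(cardsID S (neighbours v)) setDE.
have := hW v; rewrite /F !inE; case: (v \in S); rewrite !inE.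
  by case/orP=> /eqP[-> ->] /=; lia.
by move=> /eqP[-> ->] /=.
Qed.

(** * The two implications *)

Lemma efficient_of_small_perfect (G : sgraph) (c : G -> G -> shield)
    (P : {set {set magnification c}}) :
  cubic G -> contact_assignment c -> perfect_edge_dominating P ->
  10 * #|P| <= 57 * #|G| ->
  exists D : {set {set G}}, efficient_edge_dominating D.
Proof.
move=> hcubic hc perfP; set T := covered P.
have := perfect_perfect_at perfP; rewrite -/T => /(perfect_magnification T hc).
rewrite (perfect_edges_induced perfP) -/T => perfT leP.
have typ v : local_type (copy_bits T v) (contact_bits T v).
  apply: local_perfect_type (perfT v) => i /existsP[w /and3P[vw /eqP<- _]].
  exact: contact_vals.
(* Contact 2 can stand for all three, since [local_type] gives them the same state. *)
pose S := [set v | copy_bits T v 2].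
have TS v w : adj v w -> (((w, c w v) : magnification c) \in T) = (w \in S).
  rewrite adj_sym => wv; rewrite -copy_bitsE inE.
  have /and3P[/eqP e6 /eqP e10 _] := typ w.
  by have := contact_vals hc wv; rewrite !inE => /or3P[]/eqP->.
have kW v : (degree_in S v, local_weight (copy_bits T v) (contact_bits T v))
    \in if v \in S then [:: (1, 15); (3, 33)] else [:: (3, 6)].
  have /and3P[_ _] := typ v.
  by rewrite (degree_in_contact_bits hc (TS v)) [v \in S]inE.
have := sum_weights hcubic kW.
rewrite -double_card_induced_magnification //; set F := [set v in S | _].
(* Here [sumE] reads 10 |P| = 57 n + 108 |F|, so the size bound forces [F] to be empty. *)
move=> sumE; have /eqP : #|F| = 0 by lia.
rewrite cards_eq0 => /eqP F0; exists (induced_edges S).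
have one : {in S, forall v, degree_in S v = 1}.
  move=> v vS; apply/eqP; apply: contraT => kv.
  by have := in_set0 v; rewrite -F0 inE vS kv.
apply: induced_edges_efficient => // v; rewrite /perfect_at hcubic.
have := kW v; case: (boolP (v \in S)) => [vS _|_]; first by rewrite one // orbT.
by rewrite mem_seq1 => /eqP[->].
Qed.

(* Over an uncovered vertex the uncovered vertices of the shield are the
   contacts and the vertices of degree 2.  Over a vertex matched through the
   contact k they are the three vertices at distance 3 or 6 from k along the
   12-cycle. *)
Definition lift_cover (G : sgraph) (c : G -> G -> shield) (S : {set G}) :
    {set magnification c} :=
  [set x : G * shield |
     if x.1 \in S then
       [forall w, adj x.1 w && (w \in S) ==>
          (val x.2 %% 3 != val (c x.1 w) %% 3) || (x.2 == c x.1 w)]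
     else odd (val x.2)].

(** The values 2, 6, 10 are distinct modulo 3, so over [S] a contact with the residue of the chosen
    one is that contact itself; they are also even, so outside [S] no contact is covered. *)
Lemma lift_cover_contact (G : sgraph) (c : G -> G -> shield) (S : {set G})
    (v w : G) :
  contact_assignment c -> adj v w ->
  (((w, c w v) : magnification c) \in lift_cover c S) = (w \in S).
Proof.
move=> hc; rewrite adj_sym => wv; rewrite inE /=.
have := contact_vals hc wv; case: ifP => _ cwv.
  apply/forallP => u; apply/implyP => /andP[wu _].
  have := contact_vals hc wu; rewrite -val_eqE /=; move: cwv; rewrite !inE.
  by case/or3P=> /eqP->; case/or3P=> /eqP->.
by move: cwv; rewrite !inE => /or3P[]/eqP->.
Qed.

(** The state of a copy depends only on the contact towards the unique neighbour in [S], or on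
    nothing when [v] is outside [S]. This leaves four concrete computations. *)
Lemma lift_cover_local (G : sgraph) (c : G -> G -> shield) (S : {set G})
    (v : G) :
  cubic G -> contact_assignment c ->
  degree_in S v = (if v \in S then 1 else 3) ->
  let b := copy_bits (lift_cover c S) v in
  let e := contact_bits (lift_cover c S) v in
  local_perfect b e /\ local_weight b e = (if v \in S then 15 else 6).
Proof.
move=> hcubic hc; case: ifPn => vS kv b e.
  have /eqP/cards1P[w Nv] := kv.
  have Nw u : adj v u && (u \in S) = (u == w) by rewrite -in_set1 -Nv !inE.
  have /andP[vw wS] : adj v w && (w \in S) by rewrite Nw.
  pose k := val (c v w).
  have eb : {in gtn 12, b =1 fun i => (i %% 3 != k %% 3) || (i == k)}.
    move=> i i12; rewrite /b /copy_bits inE /= vS.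
    apply/forallP/idP => [/(_ w)|H u]; rewrite Nw -?val_eqE /= ?inordK //.
      by rewrite eqxx.
    by apply/implyP => /eqP->.
  have ee : {in gtn 12, e =1 pred1 k}.
    move=> i _; apply/existsP/eqP => [[u]|->].
      case/and3P=> vu /eqP<-; rewrite lift_cover_contact // => uS.
      by have := Nw u; rewrite vu uS => /esym/eqP->.
    by exists w; rewrite vw lift_cover_contact // wS eqxx.
  rewrite (eq_local_perfect eb ee) (eq_local_weight eb ee).
  have : k \in [:: 2; 6; 10] by apply: contact_vals.
  by rewrite !inE => /or3P[]/eqP->.
have NvS : neighbours v \subset S.
  apply/setIidPl/eqP; rewrite eqEcard subsetIl.
  by rewrite -/(degree_in S v) kv hcubic.
have eb : {in gtn 12, b =1 odd}.
  by move=> i i12; rewrite /b /copy_bits inE /= (negPf vS) inordK.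
have ee : {in gtn 12, e =1 fun i => i \in [:: 2; 6; 10]}.
  move=> i _; rewrite -(contact_bits_setT v i hc); apply: eq_existsb => u.
  case vu: (adj v u) => //=; rewrite lift_cover_contact // [in RHS]inE.
  by rewrite (subsetP NvS) ?inE.
by rewrite (eq_local_perfect eb ee) (eq_local_weight eb ee).
Qed.

Lemma small_perfect_of_efficient (G : sgraph) (c : G -> G -> shield)
    (D : {set {set G}}) :
  cubic G -> contact_assignment c -> efficient_edge_dominating D ->
  exists2 P : {set {set magnification c}},
    perfect_edge_dominating P & 10 * #|P| = 57 * #|G|.
Proof.
move=> hcubic hc effD; pose S := covered D.
have one : {in S, forall v, degree_in S v = 1} := efficient_degree_in effD.
(* Outside the cover only the first alternative of [perfect_at] is available, so all three
   neighbours are covered. *)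
have kS v : degree_in S v = if v \in S then 1 else 3.
  case: ifPn => [/one //|vS].
  have := perfect_perfect_at (efficient_perfect effD) v.
  by rewrite /perfect_at -/S (negPf vS) orbF hcubic => /eqP.
have loc v := lift_cover_local hcubic hc (kS v).
exists (induced_edges (lift_cover c S)).
  apply: induced_edges_perfect; apply/perfect_magnification => // v.
  by have [] := loc v.
rewrite -[10]/(5 * 2) -mulnA double_card_induced_magnification //.
rewrite (sum_weights (S := S) hcubic) => [|v]; last first.
  by rewrite kS (loc v).2; case: ifP; rewrite !inE eqxx.
(* No shield has the third type, so the term with factor 108 vanishes. *)
rewrite (_ : [set v in S | _] = set0) ?cards0 ?muln0 ?addn0 //.
by apply/setP => v; rewrite in_set0 in_set kS; case: (v \in S).
Qed.

Import Order.TTheory GRing.Theory Num.Theory.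
Local Open Scope ring_scope.

Theorem theorem3 (G : sgraph) (n : nat) (c : G -> G -> shield)
    (hcubic : cubic G) (hn : #|G| = n) (hc : contact_assignment c) :
  (exists D : {set {set G}}, efficient_edge_dominating D) <->
  (exists P : {set {set magnification c}},
     perfect_edge_dominating P /\ #|P|%:R <= 57 * n%:R / 10 :> rat).
Proof.
have leE (p : nat) : (p%:R <= 57 * n%:R / 10 :> rat) = (10 * p <= 57 * #|G|)%N.
  by rewrite hn ler_pdivlMr // -!natrM ler_nat mulnC.
split=> [[D effD]|[P [perfP]]]; last first.
  by rewrite leE; apply: efficient_of_small_perfect.
have [P perfP cardP] := small_perfect_of_efficient hcubic hc effD.
by exists P; rewrite leE cardP.
Qed.
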